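(* Let $T$ be a finite abelian group, let $\psi\colon T\to\mathbb{R}/\mathbb{Z}$ be $2$-linear, and let $K\subset T$ be a subgroup such that $\psi(k)=0$ for all $k\in K$. Then $$G(\psi)=|K|\cdot G\bigl(\psi_{K^\perp/K}\bigr).$$
   Context: A function $\psi\colon T\to\mathbb{R}/\mathbb{Z}$ on a finite abelian group is $2$-linear if $b(x,y)=\psi(x+y)-\psi(x)-\psi(y)$ is bilinear in $(x,y)$. For a function $\psi$ on a finite set $S$ with values in $\mathbb{R}/\mathbb{Z}$, the Gauss sum is $G(\psi)=\sum_{s\in S}e^{2\pi i\psi(s)}$. For a subgroup $K\subset T$, $K^\perp=\{t\in T: b(t,k)=0\ \forall k\in K\}$. If $\psi|_K=0$ then $K\subset K^\perp$, and $\psi_{K^\perp/K}\colon K^\perp/K\to\mathbb{R}/\mathbb{Z}$ denotes the well-defined function induced by $\psi|_{K^\perp}$. No tameness, quadraticity or non-singularity of $\psi$ is assumed. *)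

(* Defs.v *)
From HB Require Import structures.
From mathcomp Require Import all_boot all_order all_algebra all_fingroup.
From mathcomp Require Import complex.
From mathcomp Require Import reals sequences exp trigo.

Set Implicit Arguments.
Unset Strict Implicit.
Unset Printing Implicit Defensive.

Import Order.TTheory GRing.Theory Num.Theory.

Local Open Scope ring_scope.
Local Open Scope quotient_scope.

Definition Zsubgroup (R : realType) : zmodClosed R :=
  GRing.ZmodClosed.clone R (@Num.int_num_subdef R) _.

Notation RmodZ R := (Quotient.quot (Zsubgroup R)).

Section Exponential.
Variable R : realType.

Definition cexp (z : R[i]) : R[i] :=
  let: (a +i* b)%C := z in ((expR a)%:C * (cos b +i* sin b))%C.

(* u |-> e^(2 pi i u) on R/Z, through the canonical representative of u;
   [e_modZ_pi] shows that any other representative gives the same value. *)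
Definition e_modZ (u : RmodZ R) : R[i] := cexp ((2 * pi * generic_quotient.repr u)*i)%C.

Lemma cos_sin_periodz (m : int) (y : R) :
  cos (y + 2 * pi * m%:~R) = cos y /\ sin (y + 2 * pi * m%:~R) = sin y.
Proof.
have H (n : nat) (z : R) :
    cos (z + 2 * pi * n%:R) = cos z /\ sin (z + 2 * pi * n%:R) = sin z.
  have -> : 2 * pi * n%:R = (pi *+ 2) *+ n :> R by rewrite mulr_natr mulr_natl.
  by rewrite (periodicn (@cosD2pi R)) (periodicn (@sinD2pi R)).
case: m => n; first exact: H.
rewrite NegzE mulrNz mulrN -pmulrn.
by have [cH sH] := H n.+1 (y - 2 * pi * n.+1%:R); rewrite -cH -sH subrK.
Qed.

Lemma e_modZ_pi (x : R) : e_modZ (\pi_(RmodZ R) x) = cexp ((2 * pi * x)*i)%C.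
Proof.
rewrite /e_modZ; move: (generic_quotient.reprK (\pi_(RmodZ R) x)).
move: (generic_quotient.repr _) => r /eqP.
rewrite eq_sym -Quotient.idealrBE => /intrP[m xrm].
have {xrm} -> : x = r + m%:~R by rewrite -xrm addrC subrK.
have [cE sE] := cos_sin_periodz m (2 * pi * r).
by rewrite (mulrDr (2 * pi) r) /cexp cE sE.
Qed.

End Exponential.

Section GaussSum.
Variable R : realType.

Definition gauss_sum (S : finType) (A : {set S}) (psi : S -> RmodZ R) : R[i] :=
  \sum_(s in A) e_modZ (psi s).

End GaussSum.

Section TwoLinear.
Variables (R : realType) (T : finZmodType) (psi : T -> RmodZ R).

Definition polar (x y : T) : RmodZ R := psi (x + y) - psi x - psi y.

Definition two_linear : Prop :=
  (forall z, {morph polar^~ z : x y / x + y}) /\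
  (forall z, {morph polar z : x y / x + y}).

Definition perp (K : {set T}) : {set T} :=
  [set t | [forall k in K, polar t k == 0]].

Lemma perpP (K : {set T}) t :
  reflect (forall k, k \in K -> polar t k = 0) (t \in perp K).
Proof. by rewrite inE; apply: 'forall_in_eqP. Qed.

(* Group quotients live in the group underlying [T], whose law is the
   addition of [T]; [coset_of K] is the type of the cosets of [K] in [T]. The
   value on a coset is read off at its canonical representative, and
   [induced_coset] shows that on the cosets [t + K] with [t] in [perp K] this is
   the function induced by [psi] (values on other cosets are never used). *)
Definition induced (K : {group T}) (c : coset_of K) : RmodZ R := psi (fingroup.repr c).

Hypothesis psi2 : two_linear.

Lemma group_set_perp (K : {set T}) : group_set (perp K).
Proof.
apply/group_setP; split=> [|x y /perpP xP /perpP yP]; apply/perpP => k kK.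
  by apply: (addIr (polar 0 k)); rewrite add0r -[LHS](psi2.1 k) addr0.
by rewrite [LHS](psi2.1 k) xP// yP// addr0.
Qed.

Variable K : {group T}.
Hypothesis psiK : forall k, k \in K -> psi k = 0.

Lemma sub_perp : K \subset perp K.
Proof.
apply/subsetP=> x xK; apply/perpP=> k kK.
by rewrite /polar !psiK ?subr0//; exact: (groupM xK kK).
Qed.

Lemma induced_coset t : t \in perp K -> induced (coset K t) = psi t.
Proof.
move=> /perpP tP; rewrite /induced.
have tN : t \in 'N(K)%g.
  by apply: (subsetP (sub_abelian_norm (FinRing.zmod_abelian [set: T]) (subsetT K))).
have := mem_repr_coset (coset K t); rewrite val_coset// => /rcosetP[k kK ->].
have -> : (k * t)%g = t + k by exact: addrC.
by have /eqP := tP k kK; rewrite /polar (psiK kK) subr0 subr_eq0 => /eqP.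
Qed.

End TwoLinear.

Arguments induced {R T} psi K c.

(* Main.v *)
(** Translating the summation variable by [k] in [K] multiplies the summand
    [e (psi t)] by [e (b (t, k))], because [psi] vanishes on [K]. Averaging over
    [k], orthogonality of the character [b (t, -)] of [K] kills every [t] outside
    [perp K]. What remains is a sum over [perp K] of a function constant on the
    cosets of [K]. *)

Require Import Defs.
From mathcomp Require Import all_boot all_order all_algebra all_fingroup.
From mathcomp Require Import complex reals.
From mathcomp Require Import sequences exp trigo ring lra.
Import Order.TTheory GRing.Theory Num.Theory.
Local Open Scope ring_scope.

Section ExponentialModZ.
Variable R : realType.
Implicit Types u v : RmodZ R.

Lemma e_modZD u v : e_modZ (u + v) = e_modZ u * e_modZ v.
Proof.
elim/generic_quotient.quotW: u => x; elim/generic_quotient.quotW: v => y.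
rewrite -(raddfD (\pi_(RmodZ R)%qT)) !e_modZ_pi mulrDr /cexp expR0 cosD sinD.
by rewrite !mul1r; apply/eqP; rewrite eq_complex /=; apply/andP; split;
  apply/eqP; ring.
Qed.

(** By periodicity [x] may be replaced by its fractional part [r]. The double-angle formula then
    gives [sin (pi * r) = 0], while the sine is positive on the open interval from 0 to [pi]; hence
    [r = 0]. *)
Lemma cos_2pi_eq1 (x : R) : cos (2 * pi * x) = 1 -> x \is a Num.int.
Proof.
set r := x - (Num.floor x)%:~R.
have /andP[r_ge0 r_lt1] : 0 <= r < 1.
  have := floor_itv x; rewrite intrD /r; lra.
have xE : x = r + (Num.floor x)%:~R by rewrite subrK.
have [cosE _] := cos_sin_periodz (Num.floor x) (2 * pi * r).
rewrite {1}xE mulrDr cosE -mulrA mulr_natl cos_mulr2n => cos1.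
have sin0 : sin (pi * r) = 0.
  apply/eqP; rewrite -sqrf_eq0 sin2cos2; apply/eqP; lra.
suff r0 : r = 0 by rewrite xE r0 add0r intr_int.
apply/eqP; rewrite eq_le r_ge0 andbT leNgt; apply/negP => r_gt0.
suff : 0 < sin (pi * r) by rewrite sin0 ltxx.
by apply: sin_gt0_pi; rewrite mulr_gt0 ?pi_gt0//= gtr_pMr ?pi_gt0.
Qed.

(** Faithfulness of the exponential: a nonzero value of [polar] yields a factor different from 1 in
    the orthogonality argument. *)
Lemma e_modZ_eq1 u : e_modZ u = 1 -> u = 0.
Proof.
elim/generic_quotient.quotW: u => x.
rewrite e_modZ_pi /cexp expR0 mul1r => -[/cos_2pi_eq1 x_int _].
apply/eqP; rewrite -(raddf0 (\pi_(RmodZ R)%qT)) -Quotient.idealrBE subr0.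
exact: x_int.
Qed.

Lemma e_modZ0 : e_modZ (0 : RmodZ R) = 1.
Proof.
rewrite -(raddf0 (\pi_(RmodZ R)%qT)) e_modZ_pi mulr0 /cexp expR0 cos0 sin0.
by rewrite mul1r.
Qed.

End ExponentialModZ.

Section Reduction.
Variables (R : realType) (T : finZmodType) (psi : T -> RmodZ R).
Variable K : {group T}.
Hypothesis psi2 : two_linear psi.

(** If [polar psi t h] is nonzero for some [h] in [K], translating the index by [h] shows that the
    sum equals itself times a factor other than 1, so it vanishes. *)
Lemma sum_polar t :
  \sum_(k in K) e_modZ (polar psi t k) = #|K|%:R *+ (t \in perp psi K).
Proof.
have [/perpP tP|] := boolP (t \in perp psi K).
  by under eq_bigr => k kK do rewrite tP// e_modZ0; rewrite sumr_const mulr1n.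
rewrite inE negb_forall_in => /exists_inP[h hK bh_neq0].
set S := \sum_(k in K) _; suff : (e_modZ (polar psi t h) - 1) * S = 0.
  move/eqP; rewrite mulf_eq0 subr_eq0 => /orP[/eqP/e_modZ_eq1 bh0|/eqP//].
  by rewrite bh0 eqxx in bh_neq0.
rewrite mulrBl mul1r; apply/eqP; rewrite subr_eq0; apply/eqP.
(* The group law is the addition of [T], so additivity of [polar] in its second argument matches the
   terms. *)
rewrite mulr_sumr [RHS](reindex_inj (mulgI h)).
apply: eq_big => k; first by rewrite groupMl.
by move=> _; rewrite -e_modZD -(psi2.2 t).
Qed.

Hypothesis psiK : forall k, k \in K -> psi k = 0.

Lemma gauss_sum_perp : gauss_sum [set: T] psi = gauss_sum (perp psi K) psi.
Proof.
have K_neq0 : #|K|%:R != 0 :> R[i] by rewrite pnatr_eq0 -lt0n cardG_gt0.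
(* After scaling by the order of [K], the left side is one copy of the Gauss sum per [k] in [K]; the
   copy at [k] is reindexed by adding [k] to [t]. *)
apply: (mulfI K_neq0); rewrite mulr_natl -sumr_const /gauss_sum.
rewrite (eq_bigr (fun k => \sum_t e_modZ (psi t) * e_modZ (polar psi t k))).
  rewrite exchange_big [\sum_(s in perp _ _) _]big_mkcond mulr_sumr.
  apply: eq_bigr => t _; rewrite -mulr_sumr sum_polar.
  by case: ifP; rewrite ?mulr1n ?mulr0n ?mulr0// mulrC.
move=> k kK; rewrite (reindex_inj (addIr k)).
apply: eq_big => [t|t _]; first by rewrite !inE.
rewrite -e_modZD; congr e_modZ.
by rewrite /polar (psiK _ kK) subr0 [RHS]addrC subrK.
Qed.

End Reduction.

Lemma norm_finZmod (T : finZmodType) (K : {group T}) (t : T) : t \in 'N(K)%g.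
Proof.
exact: (subsetP (sub_abelian_norm (FinRing.zmod_abelian [set: T]) (subsetT K))).
Qed.

(** Each fibre of [coset K] on [G] is a full right coset of [K], because [K] lies in [G]; it
    therefore has [#|K|] elements. *)
Lemma sum_coset (V : nmodType) (gT : finGroupType) (G K : {group gT})
    (F : coset_of K -> V) : (K <| G)%g ->
  \sum_(x in G) F (coset K x) = (\sum_(c in (G / K)%g) F c) *+ #|K|.
Proof.
move=> /andP[sKG nKG].
rewrite (partition_big (coset K) (mem (G / K)%g)) => [|x]; last first.
  exact: mem_quotient.
rewrite -sumrMnl; apply: eq_bigr => _ /morphimP[x nKx xG ->] /=.
rewrite (eq_bigl (mem (K :* x)%g)) => [|y /=].
  rewrite (eq_bigr (fun=> F (coset K x))) => [|_ /rcosetP[k kK ->]].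
    by rewrite sumr_const card_rcoset.
  by rewrite coset_kerl.
apply/idP/idP => [/andP[yG /eqP cyx]|yKx].
  by apply/rcoset_kercosetP => //; apply: (subsetP nKG).
have yG : y \in G.
  by case/rcosetP: yKx => k kK ->; rewrite groupM ?(subsetP sKG k).
by rewrite yG /=; apply/eqP; apply/rcoset_kercosetP => //; apply: (subsetP nKG).
Qed.

Theorem theorem1p12 (R : realType) (T : finZmodType) (psi : T -> RmodZ R)
    (K : {group T}) (psi2 : two_linear psi)
    (psiK : forall k : T, k \in K -> psi k = 0) :
  gauss_sum [set: T] psi =
  #|K|%:R * gauss_sum (perp psi K / K)%g (induced psi K).
Proof.
rewrite (gauss_sum_perp _ _ _ _ psi2 psiK) mulr_natl.
have nKP : (K <| Group (group_set_perp psi2 K))%g.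
  rewrite /normal sub_perp//=; apply/subsetP => t _; exact: norm_finZmod.
(* Unfolding the quotient sum to one over [perp psi K] lets [induced_coset] compare the summands
   term by term. *)
rewrite -(sum_coset _ _ _ _ (fun c => e_modZ (induced psi K c)) nKP).
by apply: eq_bigr => t tP; rewrite induced_coset.
Qed.
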